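(* Assume that $g$ defines an elliptical family on $\mathbb{R}^p$ and satisfies G1, G2 and Gp, and let $\mathcal{X}=\{x_1,\ldots,x_n\}\subset\mathbb{R}^p$ be a data set. Let $A$ be a Borel set in $\mathbb{R}^p$ such that the number of points, $m$, in the set $\mathcal{X}\cap A$ satisfies $m>2$ if $p=1$, and $m>\frac{p\gamma}{\gamma-p/2}$ in the case $p>1$, where $\gamma$ is the constant which appears in Gp. Given $\alpha>0$, let $$\Theta_A^\alpha:=\{\theta\in\Theta:\mathbb{P}_\theta(A)\ge\alpha\}.$$ If the points in $\mathcal{X}\cap A$ are in general position, then there exists $\hat\theta_{r,n}\in\Theta_A^\alpha$ such that $$P_nL^t_{\hat\theta_{r,n}/A}=\sup_{\theta\in\Theta_A^\alpha}P_nL^t_{\theta/A}.$$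
   Context: $\mathcal{M}^+_{p\times p}$ is the set of positive definite symmetric $p\times p$ matrices and $\Theta=\mathbb{R}^p\times\mathcal{M}^+_{p\times p}$. Elliptical family: for a nonincreasing $g:\mathbb{R}^+\to\mathbb{R}^+$ (with $\mathbb{R}^+=[0,\infty)$), the family $\{\mathbb{P}_\theta:\theta\in\Theta\}$ of probabilities on the Borel sets of $\mathbb{R}^p$ with Lebesgue densities $f_\theta(x)=|\Sigma|^{-1/2}g((x-\mu)^T\Sigma^{-1}(x-\mu))$, $\theta=(\mu,\Sigma)$, where $|\Sigma|$ is the determinant of $\Sigma$. Conditions. G1: there is a strictly decreasing sequence $\{t_k\}$ converging to $0$ with $g(t_k)<g(t_{k+1})$ for every $k$. G2: $g$ is continuous on $\mathbb{R}^+$. Gp: if $p>1$, there exists $\gamma>p/2$ with $\lim_{r\to\infty}r^\gamma g(r)=0$. Points of $\mathbb{R}^p$ are in general position if no $p+1$ of them lie in a common (affine) hyperplane. $P_n$ is the empirical distribution of $\mathcal{X}$, $P_nh=\frac1n\sum_{i=1}^n h(x_i)$, and the truncated log-likelihood is $L^t_{\theta/A}(x)=I_A(x)\log\frac{f_\theta(x)}{\mathbb{P}_\theta(A)}$, $x\in\mathbb{R}^p$, where $I_A$ is the indicator function of $A$, with the conventions $0\times\infty=0$ and $L^t_{\theta/A}=-\infty$ if $\mathbb{P}_\theta(A)=0$.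
   Formalization: For p=1 it is also assumed that some γ>1/2 has r^γ g(r)→0 and m>γ/(γ−1/2), since with only m>2 a heavy-tailed g can make the supremum infinite; and Θ_A^α is assumed nonempty. *)

(* Defs.v *)
From HB Require Import structures.
From mathcomp Require Import all_boot all_order all_algebra.
From mathcomp Require Import all_classical all_reals all_analysis.
Set Implicit Arguments.
Unset Strict Implicit.
Unset Printing Implicit Defensive.
Import Order.TTheory GRing.Theory Num.Theory.
Import numFieldNormedType.Exports.
Local Open Scope classical_set_scope.
Local Open Scope ring_scope.

(* R^p is [p.-tuple R], whose [measurable] sets form the sigma-algebra
   generated by the coordinates, i.e. the Borel sets of R^p.
   The library has no Lebesgue measure on R^p: it is built here by induction
   on p as the image of (Lebesgue on R) x (Lebesgue on R^p) under the
   identification of R x R^p with R^p.+1; [lebesgueT_box] below checks it on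
   boxes. *)
Section lebesgue_tuple.
Context {R : realType}.

(* [lebesgue_measure] lives on [measurableTypeR R]; this is the same function
   on the measurable type [R] itself, which has the same measurable sets. *)
Definition lebesgueR : set R -> \bar R := lebesgue_measure.

Let lebesgueR0 : lebesgueR set0 = 0%E.
Proof. exact: (measure0 (@lebesgue_measure R)). Qed.

Let lebesgueR_ge0 A : (0 <= lebesgueR A)%E.
Proof. exact: (measure_ge0 (@lebesgue_measure R)). Qed.

Let lebesgueR_semi_sigma_additive : semi_sigma_additive lebesgueR.
Proof. exact: (@measure_semi_sigma_additive _ _ _ (@lebesgue_measure R)). Qed.

HB.instance Definition _ := isMeasure.Build _ _ _ lebesgueR
  lebesgueR0 lebesgueR_ge0 lebesgueR_semi_sigma_additive.

Let lebesgueR_sigma_finite : sigma_finite setT lebesgueR.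
Proof. exact: (sigma_finiteT (@lebesgue_measure R)). Qed.

HB.instance Definition _ := @Measure_isSigmaFinite.Build _ _ _ lebesgueR
  lebesgueR_sigma_finite.

Definition cons_pair n (z : R * n.-tuple R) : n.+1.-tuple R :=
  [the n.+1.-tuple R of z.1 :: z.2].

Lemma measurable_cons_pair n :
  measurable_fun [set: R * n.-tuple R] (@cons_pair n).
Proof. exact: measurable_cons. Qed.

Lemma measurable_uncons n :
  measurable_fun [set: n.+1.-tuple R]
    (fun t : n.+1.-tuple R => (thead t, [tuple of behead t])).
Proof.
apply/measurable_fun_pairP; split.
  exact: (measurable_tnth ord0).
exact: measurable_behead.
Qed.

Lemma cons_pairK n (z : R * n.-tuple R) :
  (thead (cons_pair z), [tuple of behead (cons_pair z)]) = z.
Proof. by case: z => a t; congr pair; apply: val_inj. Qed.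

Section step.
Variables (n : nat) (mu : {sigma_finite_measure set (n.-tuple R) -> \bar R}).

Definition lebesgue_step : set (n.+1.-tuple R) -> \bar R :=
  pushforward (lebesgueR \x mu)%E (@cons_pair n).

HB.instance Definition _ := Measure.copy lebesgue_step
  (measure_function_pushforward__canonical__measure_function_Measure
     (lebesgueR \x mu)%E (@measurable_cons_pair n)).

Let lebesgue_step_sigma_finite : sigma_finite setT lebesgue_step.
Proof.
have /sigma_finiteP[F [TF ndF Foo]] := sigma_finiteT lebesgueR.
have /sigma_finiteP[G [TG ndG Goo]] := sigma_finiteT mu.
pose h (t : n.+1.-tuple R) := (thead t, [tuple of behead t]).
have hK A : @cons_pair n @^-1` (h @^-1` A) = A.
  by apply/seteqP; split=> z /=; rewrite /h cons_pairK.
exists (fun k => h @^-1` (F k `*` G k)).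
  apply/seteqP; split=> // t _.
  have [i _ Fi] : (\bigcup_k F k) (thead t) by rewrite -TF.
  have [j _ Gj] : (\bigcup_k G k) [tuple of behead t] by rewrite -TG.
  exists (maxn i j) => //; split.
    by move: Fi; exact/subsetPset/ndF/leq_maxl.
  by move: Gj; exact/subsetPset/ndG/leq_maxr.
move=> k; have [mF Fk] := Foo k; have [mG Gk] := Goo k; split.
  by rewrite -[X in measurable X]setTI; apply: measurable_uncons => //;
     exact: measurableX.
rewrite /lebesgue_step /pushforward hK product_measure1E//.
by rewrite lte_mul_pinfty// ge0_fin_numE.
Qed.

HB.instance Definition _ := @Measure_isSigmaFinite.Build _ _ _
  lebesgue_step lebesgue_step_sigma_finite.
End step.

Fixpoint lebesgueT p : {sigma_finite_measure set (p.-tuple R) -> \bar R} :=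
  match p with
  | 0 => \d_[tuple]
  | n.+1 => lebesgue_step (lebesgueT n)
  end.

Lemma lebesgueT_box p (a b : 'I_p -> R) : (forall i, a i <= b i) ->
  lebesgueT p [set t | forall i, tnth t i \in `[a i, b i]]
  = (\prod_(i < p) (b i - a i))%:E.
Proof.
elim: p a b => [|p IHp] a b ab.
  by rewrite big_ord0 /= diracE mem_set//= => -[].
rewrite /= /lebesgue_step /pushforward.
rewrite [X in (_ \x _)%E X](_ : _ = `[a ord0, b ord0]%classic `*`
    [set t | forall i, tnth t i \in `[a (lift ord0 i), b (lift ord0 i)]]).
  rewrite product_measure1E//; last first.
    rewrite [X in measurable X](_ : _ = \bigcap_(i in [set: 'I_p])
      ((@tnth _ R ^~ i) @^-1` `[a (lift ord0 i), b (lift ord0 i)])).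
      apply: fin_bigcap_measurable => // i _.
      by rewrite -[X in measurable X]setTI; exact: measurable_tnth.
    by apply/seteqP; split=> t /= h i; [move=> _|]; exact: h.
  have lebE : lebesgueR `[a ord0, b ord0]%classic = (b ord0 - a ord0)%:E.
    rewrite [LHS](lebesgue_measure_itv `[a ord0, b ord0]) /= lte_fin.
    by case: ltgtP (ab ord0) => // -> _; rewrite subrr.
  by rewrite IHp// big_ord_recl EFinM -lebE.
apply/seteqP; split=> -[y t] /=.
  move=> h; split; first exact: (h ord0).
  by move=> i; have := h (lift ord0 i); rewrite tnthS.
move=> [h0 h] i; case: (unliftP ord0 i) => [j ->|->]; last exact: h0.
by rewrite tnthS.
Qed.
End lebesgue_tuple.

Section elliptical.
Context {R : realType} {p : nat}.
Implicit Types (g : R -> R) (th : 'cV[R]_p * 'M[R]_p) (A : set (p.-tuple R)).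

Definition colv (x : p.-tuple R) : 'cV[R]_p := \col_i tnth x i.

Definition posdefmx (S : 'M[R]_p) : Prop :=
  S^T = S /\ forall v : 'cV[R]_p, v != 0 -> 0 < (v^T *m S *m v) 0 0.

Definition Theta : set ('cV[R]_p * 'M[R]_p) := [set th | posdefmx th.2].

Definition density g th (x : p.-tuple R) : R :=
  (Num.sqrt (\det th.2))^-1 *
  g (((colv x - th.1)^T *m invmx th.2 *m (colv x - th.1)) 0 0).

Definition Pth g th A : \bar R :=
  (\int[lebesgueT p]_(x in A) (density g th x)%:E)%E.

Definition trunc_loglik g th A (x : p.-tuple R) : \bar R :=
  if Pth g th A == 0%E then -oo%E
  else ((\1_A x)%:E * lne ((density g th x)%:E / Pth g th A))%E.

Definition Theta_ge g A (alpha : R) : set ('cV[R]_p * 'M[R]_p) :=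
  [set th | Theta th /\ (alpha%:E <= Pth g th A)%E].

Definition hyperplane (H : set (p.-tuple R)) : Prop :=
  exists (v : 'cV[R]_p) (c : R),
    v != 0 /\ H = [set x | (v^T *m colv x) 0 0 = c].

(* The points [x i], [i \in D], are counted by index: equal observations are
   distinct points of the family. *)
Definition general_position n (x : 'I_n -> p.-tuple R) (D : {pred 'I_n}) :=
  forall I : {set 'I_n}, I \subset D -> #|I| = p.+1 ->
  ~ exists2 H, hyperplane H & forall i, i \in I -> H (x i).
End elliptical.

Section conditions.
Context {R : realType}.
Implicit Types (g : R -> R) (gamma : R).

(* [g] is only constrained on [0, +oo[, where it is to be thought of as
   defined. *)
Definition elliptical_family p g : Prop :=
  [/\ forall r, 0 <= r -> 0 <= g r,
      forall r s, 0 <= r -> r <= s -> g s <= g r &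
      forall th : 'cV[R]_p * 'M[R]_p, Theta th -> Pth g th setT = 1%E].

Definition G1 g : Prop := exists t : nat -> R,
  [/\ forall k, t k.+1 < t k, t @ \oo --> 0 & forall k, g (t k) < g (t k.+1)].

Definition G2 g : Prop := {within [set r | 0 <= r], continuous g}.

Definition tail_decay g gamma : Prop := r `^ gamma * g r @[r --> +oo] --> 0.

Definition Gp p g gamma : Prop :=
  (1 < p)%N -> p%:R / 2 < gamma /\ tail_decay g gamma.

(* For p = 1 the decay r^(1/2) g(r) -> 0 forced by integrability does not
   bound the likelihood of [m] points: with g(r) = c (1+r)^(-1/2) ln(e+r)^(-2)
   and data 0, 1, 2, the likelihood of (0, s^2) tends to +oo as s -> 0. The
   condition below is the pair (tail condition, lower bound on [m]) required
   for p > 1, read at p = 1. *)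
Definition univariate_tail g (m : nat) : Prop := exists gamma : R,
  [/\ 1 / 2 < gamma, tail_decay g gamma & gamma / (gamma - 1 / 2) < m%:R].

Definition empirical n T (x : 'I_n -> T) (h : T -> \bar R) : \bar R :=
  ((n%:R^-1)%:E * \sum_(i < n) h (x i))%E.
End conditions.

(* Main.v *)
Require Import Defs.
From mathcomp Require Import all_boot all_order all_algebra perm.
From mathcomp Require Import all_classical all_reals all_analysis.
From mathcomp Require Import measurable_realfun.
From mathcomp Require Import ring lra zify.
Set Implicit Arguments.
Unset Strict Implicit.
Unset Printing Implicit Defensive.
Import Order.TTheory GRing.Theory Num.Theory.
Import numFieldNormedType.Exports.
Local Open Scope classical_set_scope.
Local Open Scope ring_scope.

(** Since [alpha <= P_theta(A) <= 1], truncation changes the likelihood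
    [L(theta) = prod_i f_theta(x_i)] of the [m] points in [A] by a factor
    between [1] and [alpha^-m], so it suffices that [{L >= c}] be bounded away
    from the boundary of [Theta] for every [c > 0], and that [P_theta(A)] be
    continuous in [theta].

    Let [l] be the minimum of the quadratic form of [Sigma] over vectors of sup
    norm at least 1, attained at [u]. By general position all but [p] of the
    points have [|u^T (x_i - mu)| >= d] with [d] depending on the data only, so
    their Mahalanobis distances are at least [d^2 / l] and, by the tail
    condition, [L <= K det(Sigma)^(-m/2) l^(gamma (m - p))]. As
    [det(Sigma) >= l^p], this is [O(l^(gamma (m - p) - p m / 2))], with a
    positive exponent exactly when [m > p gamma / (gamma - p/2)]: [l] is bounded
    below. Then [L <= g(0)^m det(Sigma)^(-m/2)] and
    [det(Sigma) >= l^(p-1) Sigma_ii] bound [Sigma], and the decay of [g] bounds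
    [mu]. Continuity of [P_theta(A)] is Scheffe's lemma. *)

(** * Positive definite quadratic forms *)

Section quadratic_forms.
Context {R : realType}.

Definition qform p (S : 'M[R]_p) (v : 'cV[R]_p) : R := (v^T *m S *m v) 0 0.

Definition bform p (S : 'M[R]_p) (u v : 'cV[R]_p) : R := (u^T *m S *m v) 0 0.

Lemma bformC p (S : 'M[R]_p) u v : S^T = S -> bform S u v = bform S v u.
Proof.
move=> symS; rewrite /bform -[in RHS]symS.
have -> : v^T *m S^T *m u = (u^T *m S *m v)^T by rewrite !trmx_mul trmxK mulmxA.
by rewrite [RHS]mxE.
Qed.

Lemma qform_lin p (S : 'M[R]_p) a b u v : S^T = S ->
  qform S (a *: u + b *: v) =
  a ^+ 2 * qform S u + 2 * (a * b * bform S u v) + b ^+ 2 * qform S v.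
Proof.
move=> symS.
have : qform S (a *: u + b *: v) = a * (a * bform S u u) + a * (b * bform S u v)
    + (b * (a * bform S v u) + b * (b * bform S v v)).
  rewrite /qform /bform.
  have -> : (a *: u + b *: v)^T = a *: u^T + b *: v^T.
    by apply/matrixP => i j; rewrite !mxE.
  rewrite !mulmxDl !mulmxDr.
  by rewrite -!(scalemxAl, scalemxAr) !mxE.
by rewrite (bformC v u symS) => ->; rewrite /qform /bform; ring.
Qed.

Section posdef.
Variables (p : nat) (S : 'M[R]_p).
Hypothesis pdS : posdefmx S.

Lemma qform_ge0 v : 0 <= qform S v.
Proof.
have [->|v0] := eqVneq v 0; first by rewrite /qform mulmx0 mxE.
exact/ltW/(proj2 pdS).
Qed.

Lemma cauchy_schwarz_qform u v : bform S u v ^+ 2 <= qform S u * qform S v.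
Proof.
have [->|v0] := eqVneq v 0; first by rewrite /bform /qform !mulmx0 mxE; nra.
have qv : 0 < qform S v by exact: (proj2 pdS).
(* The form at this vector equals [qform S v * (qform S u * qform S v - bform S u v ^+ 2)]. *)
have := qform_ge0 (qform S v *: u + - bform S u v *: v).
rewrite qform_lin ?(proj1 pdS)// => h.
rewrite -(ler_pM2l qv); nra.
Qed.

Lemma posdef_unitmx : S \in unitmx.
Proof.
rewrite unitmxE unitfE; apply/det0P => -[v v0 vS0].
suff : 0 < (v^T^T *m S *m v^T) 0 0 by rewrite trmxK vS0 mul0mx mxE ltxx.
by apply: (proj2 pdS); rewrite -trmx_eq0 trmxK.
Qed.

Lemma qform_invmx y : qform (invmx S) y = qform S (invmx S *m y).
Proof.
rewrite /qform trmx_mul trmx_inv (proj1 pdS) -!mulmxA (mulKVmx posdef_unitmx).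
by rewrite mulmxA.
Qed.

Lemma invmx_posdef : posdefmx (invmx S).
Proof.
split=> [|v v0]; first by rewrite trmx_inv (proj1 pdS).
rewrite -/(qform _ _) qform_invmx; apply: (proj2 pdS).
by apply: contra_neq v0 => /(congr1 (mulmx S)); rewrite mulKVmx ?mulmx0// posdef_unitmx.
Qed.

(** Cauchy-Schwarz applied to [u] and [invmx S *m y]. It is used with [u] a direction of small
    scatter: a displacement [y] visible along [u] then has a large Mahalanobis norm. *)
Lemma mahalanobis_ge u y : (u^T *m y) 0 0 ^+ 2 <= qform S u * qform (invmx S) y.
Proof.
rewrite qform_invmx; apply: le_trans (cauchy_schwarz_qform _ _).
by rewrite /bform -mulmxA mulKVmx// posdef_unitmx.
Qed.

End posdef.

Lemma qform_delta p (S : 'M[R]_p) i : qform S (delta_mx i 0) = S i i.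
Proof. by rewrite /qform trmx_delta -rowE -colE !mxE. Qed.

Lemma bform_delta p (S : 'M[R]_p) i j :
  bform S (delta_mx i 0) (delta_mx j 0) = S i j.
Proof. by rewrite /bform trmx_delta -rowE -colE !mxE. Qed.

Lemma posdef_diag_gt0 p (S : 'M[R]_p) i : posdefmx S -> 0 < S i i.
Proof.
move=> pdS; rewrite -qform_delta; apply: (proj2 pdS).
by apply/eqP => /matrixP/(_ i 0); rewrite !mxE !eqxx => /eqP; rewrite oner_eq0.
Qed.

(** Cauchy-Schwarz on basis vectors gives [S i j ^+ 2 <= S i i * S j j], so only the diagonal of the
    scatter matrix has to be controlled. *)
Lemma posdef_entry_le p (S : 'M[R]_p) b i j : posdefmx S ->
  (forall k, S k k <= b) -> `|S i j| <= b.
Proof.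
move=> pdS Sb; have := cauchy_schwarz_qform pdS (delta_mx i 0) (delta_mx j 0).
rewrite bform_delta !qform_delta => h.
have := posdef_diag_gt0 i pdS; have := posdef_diag_gt0 j pdS.
have bi := Sb i; have bj := Sb j => j0 i0.
rewrite -(@ler_pXn2r _ 2)// ?nnegrE//; last by lra.
by rewrite real_normK ?num_real//; nra.
Qed.

(* [l] is the minimum of the quadratic form over the vectors of sup norm at
   least 1. With [k] maximizing the diagonal entries of [S^-1], it is the
   inverse of the [k]-th one, attained at the multiple of [S^-1 e_k] whose
   [k]-th entry is 1. *)
Lemma posdef_min_qform p (S : 'M[R]_p) : (0 < p)%N -> posdefmx S ->
  exists (u : 'cV[R]_p) (k : 'I_p) (l : R), [/\ 0 < l, u k 0 = 1, qform S u = l &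
    forall (v : 'cV[R]__) i, l * v i 0 ^+ 2 <= qform S v].
Proof.
case: p S => // p S _ pdS; have pdV := invmx_posdef pdS.
pose V := invmx S; pose k := [arg max_(i > ord0) V i i]%O.
have kmax i : V i i <= V k k by rewrite /k; case: Order.TotalTheory.arg_maxP => // j _; apply.
have Vk : 0 < V k k by exact: posdef_diag_gt0.
exists ((V k k)^-1 *: (V *m delta_mx k 0)), k, (V k k)^-1; split.
- by rewrite invr_gt0.
- by rewrite -colE !mxE mulVf// gt_eqF.
- have := @qform_lin _ S (V k k)^-1 0 (V *m delta_mx k 0) 0 (proj1 pdS).
  rewrite scaler0 addr0 => ->; rewrite -(qform_invmx pdS) qform_delta -/V.
  by field; rewrite gt_eqF.
move=> v i; have := mahalanobis_ge pdS v (delta_mx i 0).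
rewrite qform_delta -colE !mxE => h.
rewrite mulrC ler_pdivrMr//; apply: (le_trans h).
by rewrite ler_wpM2l ?kmax// qform_ge0.
Qed.


(** * Schur complements and lower bounds on determinants *)

Section schur_complement.
Variables (n : nat) (S : 'M[R]_(1 + n)).
Hypothesis symS : S^T = S.

Let a := S 0 0.
Let b := dlsubmx S.

Definition schur : 'M[R]_n := drsubmx S - a^-1 *: (b *m b^T).

Let S_block : S = block_mx a%:M b^T b (drsubmx S).
Proof.
rewrite -[LHS]submxK; congr block_mx; last by rewrite trmx_dlsub symS.
rewrite [LHS]mx11_scalar !mxE; congr (S _ _)%:M; exact: val_inj.
Qed.

Lemma schur_sym : schur^T = schur.
Proof.
apply/matrixP => i j; have /matrixP E := trmx_mul b b^T; rewrite trmxK in E.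
by have := E i j; rewrite mxE !mxE => ->; rewrite -[in LHS]symS mxE.
Qed.

Hypothesis a0 : a != 0.

Lemma det_schur : \det S = a * \det schur.
Proof.
have -> : S = block_mx 1%:M 0 (a^-1 *: b) 1%:M *m block_mx a%:M b^T 0 schur.
  rewrite [LHS]S_block mulmx_block !mul1mx !mul0mx !addr0.
  rewrite mul_mx_scalar scalerA mulfV// scale1r -scalemxAl.
  by rewrite /schur addrCA subrr addr0.
by rewrite det_mulmx det_lblock det_ublock !det1 !mul1r det_scalar1.
Qed.

(** When [a > 0], the first coordinate used here is the one that minimizes the form of [S] among the
    extensions of [v]. Coordinatewise lower bounds on the form of [S] thus pass to its Schur
    complement. *)
Lemma qform_schur v :
  qform schur v = qform S (col_mx (- a^-1 *: (b^T *m v)) v).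
Proof.
rewrite /qform [in RHS]S_block tr_col_mx mul_row_block mul_row_col.
have -> : (- a^-1 *: (b^T *m v))^T = - a^-1 *: (v^T *m b).
  by rewrite -[in RHS](trmxK b) -trmx_mul; apply/matrixP => i j; rewrite !mxE.
rewrite mul_mx_scalar scalerA mulrN mulfV// scaleN1r addNr mul0mx add0r.
by rewrite mulmxBr -scalemxAr -scalemxAl mulmxA scaleNr addrC.
Qed.

End schur_complement.

(** Induction through [\det S = S 0 0 * \det (schur S)]: the Schur complement inherits the bound
    [l], and its own corner entry is at least [l]. Keeping [S 0 0] as a factor lets a bounded
    determinant bound the diagonal. *)
Lemma det_ge_qform_min0 n (S : 'M[R]_n.+1) l : S^T = S -> 0 < l ->
  (forall (v : 'cV[R]__) i, l * v i 0 ^+ 2 <= qform S v) -> l ^+ n * S 0 0 <= \det S.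
Proof.
elim: n S => [|n IH] S symS l0 Sl; first by rewrite expr0 mul1r det_mx11.
have diag_ge k (T : 'M[R]_k.+1) : (forall (v : 'cV[R]__) i, l * v i 0 ^+ 2 <= qform T v) ->
    l <= T 0 0.
  move=> /(_ (delta_mx 0 0) 0); rewrite qform_delta !mxE eqxx.
  by rewrite expr1n mulr1.
have a0 : 0 < S 0 0 by apply: (lt_le_trans l0); exact: diag_ge.
pose S' : 'M[R]_(1 + n.+1) := S.
have Tl (v : 'cV[R]_n.+1) i : l * v i 0 ^+ 2 <= qform (schur S') v.
  rewrite (@qform_schur _ S') ?gt_eqF//.
  apply: le_trans (Sl _ (rshift 1 i)).
  by rewrite (@col_mxEd _ 1).
rewrite (@det_schur _ S')// ?gt_eqF//.
have := IH (schur S') (schur_sym symS) l0 Tl; have := diag_ge _ _ Tl.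
set t := _ 0 0; set d := \det _ => lt td.
rewrite mulrC ler_pM2l// exprSr; apply: le_trans td.
by rewrite ler_wpM2l// exprn_ge0// ltW.
Qed.

(** Conjugation by the transposition of [0] and [i] brings [S i i] to the corner, preserves the
    determinant and only permutes the coordinates of [v]. *)
Lemma det_ge_qform_min n (S : 'M[R]_n) l i : S^T = S -> 0 < l ->
  (forall (v : 'cV[R]__) i, l * v i 0 ^+ 2 <= qform S v) -> l ^+ n.-1 * S i i <= \det S.
Proof.
case: n S i => [S []//|n S i symS l0 Sl].
pose s := tperm 0 i; pose P : 'M[R]_n.+1 := perm_mx s.
have PT : P^T = P by rewrite /P tr_perm_mx tpermV.
have S00 : (P *m S *m P) 0 0 = S i i.
  by rewrite -row_permE -[P]PT [P^T]tr_perm_mx -col_permE !mxE tpermL.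
have detP2 : \det P * \det P = 1.
  by rewrite /P det_perm -signr_addb addbb.
have <- : \det (P *m S *m P) = \det S by rewrite !det_mulmx mulrAC detP2 mul1r.
rewrite -S00; apply: det_ge_qform_min0 => //.
  by rewrite !trmx_mul PT symS mulmxA.
move=> v j; have -> : qform (P *m S *m P) v = qform S (P *m v).
  by rewrite /qform trmx_mul PT !mulmxA.
apply: le_trans (Sl _ (s j)).
by rewrite -row_permE mxE tpermK.
Qed.

Lemma det_ge_exp n (S : 'M[R]_n) l : S^T = S -> 0 < l ->
  (forall (v : 'cV[R]__) i, l * v i 0 ^+ 2 <= qform S v) -> l ^+ n <= \det S.
Proof.
case: n S => [S _ _ _|n S symS l0 lS]; first by rewrite det_mx00.
apply: le_trans (det_ge_qform_min 0 symS l0 lS).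
rewrite exprSr ler_wpM2l ?exprn_ge0 ?(ltW l0)//.
have := lS (delta_mx 0 0) 0; rewrite qform_delta !mxE !eqxx.
by rewrite expr1n mulr1.
Qed.

End quadratic_forms.

(** * Points in general position *)

Section general_position.
Context {R : realType} {p : nat}.

Definition linform (u : 'cV[R]_p) (x : p.-tuple R) : R := (u^T *m colv x) 0 0.

Lemma linformE u x : linform u x = \sum_j u j 0 * tnth x j.
Proof. by rewrite /linform mxE; apply: eq_bigr => j _; rewrite !mxE. Qed.

(** In homogeneous coordinates, points on no common hyperplane form an invertible matrix [M], and
    [M] sends [(u, c)] to the vector of the [linform u (y i) - c]. If all of these were small, so
    would be the entry [u k 0 = 1] recovered by [invmx M]. *)
Lemma simplex_gap (y : 'I_(p + 1) -> p.-tuple R) :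
  (~ exists2 H, hyperplane H & forall i, H (y i)) ->
  exists2 d : R, 0 < d & forall (u : 'cV[R]_p) k c, u k 0 = 1 ->
    exists i, d <= `|linform u (y i) - c|.
Proof.
move=> ny.
pose M : 'M[R]_(p + 1) := row_mx (\matrix_(i, j) tnth (y i) j) (const_mx (-1)).
have ME u (c : 'cV[R]_1) i : (M *m col_mx u c) i 0 = linform u (y i) - c 0 0.
  rewrite /M mul_row_col mxE [X in _ + X]mxE big_ord1 !mxE mulN1r linformE.
  by congr (_ - _); apply: eq_bigr => j _; rewrite !mxE mulrC.
have uM : M \in unitmx.
  rewrite unitmxE unitfE -det_tr; apply/det0P => -[v v0 vM]; apply: ny.
  have : M *m v^T = 0 by rewrite -[LHS]trmxK trmx_mul trmxK vM trmx0.
  rewrite -[v^T]vsubmxK; set u := usubmx _; set c := dsubmx _ => Mw.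
  have yc i : linform u (y i) = c 0 0.
    by apply/eqP; rewrite -subr_eq0 -ME Mw mxE.
  exists [set x | linform u x = c 0 0] => //; exists u, (c 0 0); split => //.
  (* The normal is nonzero: [u = 0] would force [c = 0], as read at one of the points, and then
     [v = 0]. *)
  apply: contra_neq v0 => u0; rewrite -[v]trmxK -[v^T]vsubmxK -/u -/c u0.
  have c0 : c = 0.
    rewrite [c]mx11_scalar -(yc (rshift p 0)) u0 linformE big1 ?raddf0//.
    by move=> j _; rewrite mxE mul0r.
  by rewrite c0 col_mx0 trmx0.
(* [B] dominates the absolute sum of each row of the inverse, and the gap [(1 + B)^-1] is chosen so
   that its product with [B] is below 1. *)
pose B := \sum_k \sum_l `|invmx M k l|.
have B0 : 0 <= B by apply: sumr_ge0 => k _; exact: sumr_ge0.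
exists (1 + B)^-1; first by rewrite invr_gt0; lra.
move=> u k c uk; apply: contrapT => /forallNP small.
have : `|(invmx M *m (M *m col_mx u c%:M)) (lshift 1 k) 0| < 1.
  apply: (@le_lt_trans _ _ (B * (1 + B)^-1)); last by rewrite ltr_pdivrMr; lra.
  rewrite mxE; apply: le_trans (ler_norm_sum _ _ _) _.
  have /ler_wpM2r Bk : \sum_l `|invmx M (lshift 1 k) l| <= B.
    rewrite [leRHS](bigD1 (lshift 1 k))//= lerDl.
    by apply: sumr_ge0 => ? _; exact: sumr_ge0.
  apply: le_trans (Bk _ _); last by rewrite invr_ge0 addr_ge0.
  rewrite mulr_suml; apply: ler_sum => l _; rewrite normrM ler_wpM2l//.
  rewrite ME mxE mulr1n leNgt; apply/negP => /ltW; exact: small.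
by rewrite mulKmx// col_mxEu uk normr1 ltxx.
Qed.

(** The gap is the smallest one over the finitely many subsets of [p.+1] points: more than [p]
    points near one hyperplane would include such a subset. *)
Lemma general_position_gap n (x : 'I_n -> p.-tuple R) (D : {pred 'I_n}) :
  general_position x D ->
  exists2 d : R, 0 < d & forall (u : 'cV[R]_p) k c, u k 0 = 1 ->
    (#|[set i in D | (`|linform u (x i) - c| < d)%R]| <= p)%N.
Proof.
move=> gp.
pose far d (I : {set 'I_n}) := forall (u : 'cV[R]_p) k c, u k 0 = 1 ->
  exists2 i, i \in I & d <= `|linform u (x i) - c|.
have : forall I : {set 'I_n}, exists d : R,
    0 < d /\ (I \subset D -> #|I| = p.+1 -> far d I).
  move=> I; have [[ID cI]|nI] := pselect (I \subset D /\ #|I| = p.+1); last first.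
    (* Subsets of the wrong size, or outside [D], receive the harmless gap 1. *)
    by exists 1; split => // ID cI; case: nI.
  have cI1 : (p + 1)%N = #|I| by rewrite cI addn1.
  have [|d d0 dP] := @simplex_gap (fun i => x (enum_val (cast_ord cI1 i))).
    move=> [H hH Hy]; apply: (gp I ID cI); exists H => // i iI.
    have := Hy (cast_ord (esym cI1) (enum_rank_in iI i)).
    by rewrite cast_ordKV enum_rankK_in.
  exists d; split => // _ _ u k c uk; have [i di] := dP u k c uk.
  by exists (enum_val (cast_ord cI1 i)) => //; exact: enum_valP.
move=> /choice[d dP].
exists (\big[Order.min/1]_I d I).
  by apply: lt_bigmin => // I _; case: (dP I).
move=> u k c uk; rewrite leqNgt; apply/negP => pN.
set N := [set i in D | _] in pN.
have [I IN cI] : exists2 I : {set 'I_n}, I \subset N & #|I| = p.+1.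
  exists [set i in take p.+1 (enum N)].
    by apply/fintype.subsetP => i; rewrite inE => /mem_take; rewrite mem_enum.
  rewrite cardsE (card_uniqP _) ?take_uniq ?enum_uniq//.
  by rewrite size_takel// -cardE.
have ID : I \subset D.
  by apply: fintype.subset_trans IN _; apply/fintype.subsetP => i; rewrite inE => /andP[].
have [i iI] := (dP I).2 ID cI u k c uk.
rewrite leNgt => /negP; apply.
have := fintype.subsetP IN _ iI; rewrite inE => /andP[_ /lt_le_trans]; apply.
exact: bigmin_le_cond.
Qed.

End general_position.

(** * Convergence of sequences of reals and matrices *)

Section sequences.
Context {R : realType}.

Lemma increasing_seq_cvg_infty (f : nat -> nat) :
  increasing_seq f -> f @ \oo --> \oo.
Proof.
move=> fi; have kf k : (k <= f k)%N.
  elim: k => // k IH; apply: (leq_ltn_trans IH).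
  by rewrite ltnNge -leEnat fi ltnn.
by apply/cvgnyPge => N; exists N => // k /= /leq_trans; apply.
Qed.

Lemma common_cvg_subsequence (I : finType) (u : I -> R^nat) M :
  (forall i k, `|u i k| <= M) ->
  exists2 f : nat -> nat, f @ \oo --> \oo & forall i, cvgn (u i \o f).
Proof.
move=> uM.
have [f foo fP] : exists2 f : nat -> nat, f @ \oo --> \oo &
    forall i, i \in enum I -> cvgn (u i \o f).
  (* Bolzano-Weierstrass is applied to one index at a time; further extraction preserves the limits
     already obtained. *)
  elim: (enum I) => [|i s [f foo fs]]; first by exists id => //; exact: cvg_id.
  have bd : bounded_fun (u i \o f).
    exists M; split; first exact: num_real.
    by move=> x Mx k _; exact: le_trans (uM _ _) (ltW Mx).
  have [h /increasing_seq_cvg_infty hoo uih] := bolzano_weierstrass bd.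
  exists (f \o h) => [|j]; first exact: cvg_comp foo.
  rewrite inE => /predU1P[->//|/fs/cvg_ex[l ujl]].
  by apply/cvg_ex; exists l; exact: (@cvg_comp _ _ _ h (u j \o f) _ _ _ hoo ujl).
by exists f => // i; apply: fP; rewrite mem_enum.
Qed.

(** Compactness of [S] and continuity of [f] are merged into one sequential hypothesis, so no
    topology on [T] is involved. It is applied first to a sequence along which [f] would be
    unbounded, then to a maximizing sequence. *)
Lemma max_attained_seq T (S : set T) (f : T -> R) : S !=set0 ->
  (forall t : nat -> T, (forall k, S (t k)) -> exists (h : nat -> nat) (s : T),
    [/\ h @ \oo --> \oo, S s & f (t (h k)) @[k --> \oo] --> f s]) ->
  exists2 s, S s & forall r, S r -> f r <= f s.
Proof.
move=> [s0 Ss0] seqS.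
have ub : has_ubound [set f r | r in S].
  apply: contrapT => /forallNP nub.
  have /choice[t tP] : forall k : nat, exists t, S t /\ k%:R < f t.
    move=> k; have /existsNP[y /not_implyP[[r Sr <-] /negP]] := nub k%:R.
    by rewrite -ltNge; exists r.
  have [h [s [hoo _ fs]]] := seqS t (fun k => (tP k).1).
  have /cvgnyPge/(_ (Num.bound (`|f s| + 1))) h1 := hoo.
  have /cvgrPdist_lt/(_ 1 ltr01) h2 := fs.
  have [k [hk fk]] := @filter_ex _ _ _ _ (filterI h1 h2).
  have := (tP (h k)).2; have := archi_boundP (addr_ge0 (normr_ge0 (f s)) ler01).
  move: hk fk; rewrite /= -(ler_nat R) ltr_norml => ? /andP[? ?] ? ?.
  have := ler_norm (f s); lra.
have hs : has_sup [set f r | r in S] by split => //; exists (f s0), s0.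
have /choice[t tP] : forall k : nat,
    exists t, S t /\ sup [set f r | r in S] - k.+1%:R^-1 < f t.
  move=> k; have k0 : 0 < (k.+1%:R : R)^-1 by rewrite invr_gt0.
  by have [_ [t St <-] ht] := sup_adherent k0 hs; exists t.
have [h [s [hoo Ss fs]]] := seqS t (fun k => (tP k).1).
exists s => // r Sr.
apply: (@le_trans _ _ (sup [set f r | r in S])); first by apply: ub_le_sup => //; exists r.
have harm : sup [set f r | r in S] - (h k).+1%:R^-1 @[k --> \oo] --> sup [set f r | r in S].
  rewrite -[X in _ --> X]subr0; apply: cvgB; first exact: cvg_cst.
  exact: (@cvg_comp _ _ _ h (fun k => k.+1%:R^-1) _ _ _ hoo (@cvg_harmonic R)).
by apply: (ler_cvg_to harm fs); apply: nearW => k; exact/ltW/(tP _).2.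
Qed.

Lemma cvg_within_seq (A : set R) (f : R -> R) (u : R^nat) l :
  {within A, continuous f} -> (forall k, A (u k)) -> A l ->
  u k @[k --> \oo] --> l -> f (u k) @[k --> \oo] --> f l.
Proof.
move=> /subspace_continuousP cf Au Al ul; have := cf l Al.
by apply: cvg_comp => B /= /ul[N _ NB]; exists N => // k /NB; apply.
Qed.

Lemma cvg_sum_seq (I : Type) (r : seq I) (P : pred I) (u : I -> R^nat) (l : I -> R) :
  (forall i, P i -> u i k @[k --> \oo] --> l i) ->
  \sum_(i <- r | P i) u i k @[k --> \oo] --> \sum_(i <- r | P i) l i.
Proof. by move=> ul; apply: cvg_big => //; exact: add_continuous. Qed.

Lemma cvg_prod_seq (I : Type) (r : seq I) (P : pred I) (u : I -> R^nat) (l : I -> R) :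
  (forall i, P i -> u i k @[k --> \oo] --> l i) ->
  \prod_(i <- r | P i) u i k @[k --> \oo] --> \prod_(i <- r | P i) l i.
Proof. by move=> ul; apply: cvg_big => //; exact: mul_continuous. Qed.

Definition cvg_entries m n (S_ : nat -> 'M[R]_(m, n)) (S : 'M[R]_(m, n)) : Prop :=
  forall i j, S_ k i j @[k --> \oo] --> S i j.

Lemma cvg_entries_cst m n (S : 'M[R]_(m, n)) : cvg_entries (fun=> S) S.
Proof. by move=> i j; exact: cvg_cst. Qed.

Lemma cvg_entriesB m n (S_ T_ : nat -> 'M[R]_(m, n)) S T :
  cvg_entries S_ S -> cvg_entries T_ T ->
  cvg_entries (fun k => S_ k - T_ k) (S - T).
Proof.
move=> cS cT i j; rewrite !mxE.
under eq_cvg do rewrite !mxE.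
exact: cvgB.
Qed.

Lemma cvg_entries_tr m n (S_ : nat -> 'M[R]_(m, n)) S :
  cvg_entries S_ S -> cvg_entries (fun k => (S_ k)^T) S^T.
Proof.
move=> cS i j; rewrite mxE.
under eq_cvg do rewrite mxE.
exact: cS.
Qed.

Lemma cvg_entriesM m n p (S_ : nat -> 'M[R]_(m, n)) (T_ : nat -> 'M[R]_(n, p)) S T :
  cvg_entries S_ S -> cvg_entries T_ T ->
  cvg_entries (fun k => S_ k *m T_ k) (S *m T).
Proof.
move=> cS cT i j; rewrite !mxE; under eq_cvg do rewrite !mxE.
by apply: cvg_sum_seq => l _; exact: cvgM.
Qed.

Lemma cvg_entries_det n (S_ : nat -> 'M[R]_n) S :
  cvg_entries S_ S -> \det (S_ k) @[k --> \oo] --> \det S.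
Proof.
move=> cS; apply: cvg_sum_seq => s _; apply: cvgM; first exact: cvg_cst.
exact: cvg_prod_seq.
Qed.

(** By the adjugate formula, each entry of the inverse is a signed minor divided by the
    determinant. *)
Lemma cvg_entries_inv n (S_ : nat -> 'M[R]_n) S :
  (forall k, S_ k \in unitmx) -> S \in unitmx ->
  cvg_entries S_ S -> cvg_entries (fun k => invmx (S_ k)) (invmx S).
Proof.
move=> uS_ uS cS i j; rewrite /invmx uS !mxE.
under eq_cvg do rewrite uS_ !mxE.
apply: cvgM; last apply: cvgM; first apply: cvgV.
- by rewrite -unitfE -unitmxE.
- exact: cvg_entries_det.
- exact: cvg_cst.
- apply: cvg_entries_det => a b; rewrite !mxE; under eq_cvg do rewrite !mxE.
  exact: cS.
Qed.

End sequences.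

(** * Scheffe's lemma *)

Section scheffe.
Local Open Scope ereal_scope.
Context d (T : measurableType d) (R : realType) (mu : {measure set T -> \bar R}).

(** The functions [min (f_ k) f] are dominated by [f], so their integrals converge over every
    measurable set. They bound the integral of [f_ k] over [A] from below and, since the total mass
    is 1, over the complement they bound it from above. *)
Lemma scheffe_cvg (f_ : nat -> T -> R) (f : T -> R) (A : set T) :
  measurable A ->
  (forall k, measurable_fun setT (f_ k)) -> measurable_fun setT f ->
  (forall k x, (0 <= f_ k x)%R) -> (forall x, (0 <= f x)%R) ->
  (forall x, f_ k x @[k --> \oo] --> f x) ->
  (forall k, \int[mu]_x (f_ k x)%:E = 1) -> \int[mu]_x (f x)%:E = 1 ->
  \int[mu]_(x in A) (f_ k x)%:E @[k --> \oo] --> \int[mu]_(x in A) (f x)%:E.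
Proof.
move=> mA mf_ mf f_0 f0 ff int_ int.
have mE (h : T -> R) B : measurable_fun setT h -> measurable_fun B (fun x => (h x)%:E).
  by move=> mh; apply: measurable_funTS; exact/measurable_EFinP.
have split_int (h : T -> R) : measurable_fun setT h -> (forall x, (0 <= h x)%R) ->
    \int[mu]_x (h x)%:E =
    \int[mu]_(x in A) (h x)%:E + \int[mu]_(x in ~` A) (h x)%:E.
  move=> mh h0; rewrite -ge0_integral_setU ?setUv//.
  - exact: measurableC.
  - exact: mE.
  - by move=> x _; rewrite lee_fin.
  - by rewrite disj_set2E setICr.
have intf : mu.-integrable setT (EFin \o f).
  apply/integrableP; split; first exact: mE.
  under eq_integral do rewrite gee0_abs ?lee_fin//.
  by rewrite int ltry.
have cvg_min B : measurable B ->
    \int[mu]_(x in B) (Order.min (f_ k x) (f x))%:E @[k --> \oo]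
    --> \int[mu]_(x in B) (f x)%:E.
  move=> mB.
  have mm k : measurable_fun setT (fun x => Order.min (f_ k x) (f x)).
    exact: measurable_minr.
  have [] := @dominated_convergence _ _ _ mu B mB
    (fun k x => (Order.min (f_ k x) (f x))%:E) (EFin \o f) (EFin \o f).
  - by move=> k; exact: mE (mm k).
  - exact: mE.
  - apply: aeW => x _; apply: cvg_EFin; first exact: nearW.
    (* The minimum is rewritten as [(a + b - |a - b|) / 2] to obtain its limit by arithmetic. *)
    suff : ((f_ k x + f x - `|f_ k x - f x|) / 2)%R @[k --> \oo] --> f x.
      have -> : (fun k => (f_ k x + f x - `|f_ k x - f x|) / 2)%R =
        (fun k => Order.min (f_ k x) (f x)).
        by apply/funext => k; rewrite minr_absE.
      by [].
    rewrite -[X in _ --> X](minxx (f x)) minr_absE.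
    apply: cvgM; last exact: cvg_cst.
    apply: cvgB; first by apply: cvgD => //; exact: cvg_cst.
    by apply: cvg_norm; apply: cvgB => //; exact: cvg_cst.
  - by apply: integrableS intf.
  - apply: aeW => x k _; rewrite gee0_abs ?lee_fin ?le_min ?f_0 ?f0//.
    by rewrite ge_min lexx orbT.
  - by move=> _ _.
have intD (h : T -> R) : measurable_fun setT h -> (forall x, (0 <= h x)%R) ->
    \int[mu]_x (h x)%:E = 1 ->
    \int[mu]_(x in A) (h x)%:E = 1 - \int[mu]_(x in ~` A) (h x)%:E.
  move=> mh h0; rewrite (split_int h mh h0) => h1.
  have : \int[mu]_(x in ~` A) (h x)%:E \is a fin_num.
    rewrite ge0_fin_numE ?integral_ge0// => [|x _]; last by rewrite lee_fin.
    rewrite (@le_lt_trans _ _ 1) ?ltry// -h1 leeDr// integral_ge0// => x _.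
    by rewrite lee_fin.
  by move=> fin; rewrite -h1 addeK.
have le_min_ k B : measurable B ->
    \int[mu]_(x in B) (Order.min (f_ k x) (f x))%:E <= \int[mu]_(x in B) (f_ k x)%:E.
  move=> mB; apply: ge0_le_integral => //.
  - by move=> x _; rewrite lee_fin le_min f_0 f0.
  - by apply: mE; exact: measurable_minr.
  - exact: mE.
  - by move=> x _; rewrite lee_fin ge_min lexx.
apply: (squeeze_cvge _ (cvg_min A mA) (h := fun k =>
  1 - \int[mu]_(x in ~` A) (Order.min (f_ k x) (f x))%:E)).
  apply: nearW => k; rewrite le_min_//= intD//.
  by rewrite leeB// le_min_//; exact: measurableC.
rewrite [X in _ --> X]intD//; apply: cvgeB => //.
  exact: cvg_cst.
exact/cvg_min/measurableC.
Qed.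

End scheffe.

(** * Coercivity of the likelihood *)

Section likelihood.
Context {R : realType}.

Lemma prod_le_two_bounds (I : finType) (D N : {set I}) (p : nat) (f : I -> R) (M T : R) :
  N \subset D -> (#|N| <= p <= #|D|)%N -> 0 <= T <= M ->
  (forall i, i \in D -> 0 <= f i <= M) ->
  (forall i, i \in D :\: N -> f i <= T) ->
  \prod_(i in D) f i <= M ^+ p * T ^+ (#|D| - p).
Proof.
move=> ND /andP[Np pD] /andP[T0 TM] fM fT.
have NDi i : i \in N -> i \in D by move/fintype.subsetP: ND; apply.
rewrite (big_setID N)/= (finset.setIidPr ND).
(* [N] may have fewer than [p] elements; the spare factors [M] are then matched with factors at most
   [T <= M]. *)
have -> : M ^+ p * T ^+ (#|D| - p) = M ^+ #|N| * (M ^+ (p - #|N|) * T ^+ (#|D| - p)).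
  by rewrite mulrA -exprD subnKC.
have fN0 i : i \in D -> 0 <= f i by move=> /fM/andP[].
apply: ler_pM.
- by apply: prodr_ge0 => i iN; exact: fN0 (NDi _ iN).
- by apply: prodr_ge0 => i /finset.setDP[iD _]; exact: fN0.
- rewrite -prodr_const; apply: ler_prod => i iN.
  exact: fM (NDi _ iN).
- apply: (@le_trans _ _ (T ^+ (p - #|N|) * T ^+ (#|D| - p))).
    have -> : T ^+ (p - #|N|) * T ^+ (#|D| - p) = T ^+ #|D :\: N|.
      by rewrite -exprD cardsD (finset.setIidPr ND); congr (_ ^+ _); lia.
    rewrite -prodr_const; apply: ler_prod => i iN; rewrite fT// andbT.
    by apply: fN0; case/finset.setDP: iN.
  by rewrite ler_wpM2r ?exprn_ge0// lerXn2r// nnegrE ?(le_trans T0).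
Qed.

Lemma tail_decay_bound (g : R -> R) (gamma : R) :
  (forall r, 0 <= r -> 0 <= g r) -> (forall r s, 0 <= r -> r <= s -> g s <= g r) ->
  0 < gamma -> tail_decay g gamma ->
  exists2 C, 0 < C & forall r, 0 <= r -> r `^ gamma * g r <= C.
Proof.
move=> g0 gn gam /cvgrPdist_lt/(_ 1 ltr01)[r0 [_ r0P]].
pose s := Num.max 0 (r0 + 1); have s0 : 0 <= s by rewrite le_max lexx.
exists (1 + s `^ gamma * g 0).
  by rewrite ltr_pwDl// mulr_ge0 ?powR_ge0 ?g0.
move=> r r_ge0; have [sr|rs] := ltP s r.
  have : r0 < r by apply: lt_trans sr; rewrite lt_max; apply/orP; right; lra.
  move=> /r0P; rewrite sub0r normrN => /(le_lt_trans (ler_norm _)) h.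
  by rewrite (le_trans (ltW h))// lerDl mulr_ge0 ?powR_ge0 ?g0.
apply: (@le_trans _ _ (s `^ gamma * g 0)); last by rewrite lerDr.
apply: ler_pM; rewrite ?powR_ge0 ?g0 ?gn//.
by rewrite ge0_ler_powR ?nnegrE// ltW.
Qed.


Lemma posdef_det_gt0 p (S : 'M[R]_p) : (0 < p)%N -> posdefmx S -> 0 < \det S.
Proof.
move=> p0 pdS; have [u [k [l [l0 _ _ lS]]]] := posdef_min_qform p0 pdS.
apply: lt_le_trans (det_ge_qform_min k (proj1 pdS) l0 lS).
by rewrite mulr_gt0 ?exprn_gt0 ?posdef_diag_gt0.
Qed.

Section coercivity.
Variables (p n : nat) (g : R -> R) (gamma : R) (x : 'I_n -> p.-tuple R).
Variables (D : {set 'I_n}) (c : R).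
Hypothesis p_gt0 : (0 < p)%N.
Hypothesis g_ge0 : forall r, 0 <= r -> 0 <= g r.
Hypothesis g_noninc : forall r s, 0 <= r -> r <= s -> g s <= g r.
Hypothesis gamma_gt : p%:R / 2 < gamma.
Hypothesis g_tail : tail_decay g gamma.
Hypothesis card_gt : p%:R * gamma / (gamma - p%:R / 2) < #|D|%:R.
Hypothesis gpD : general_position x D.
Hypothesis c_gt0 : 0 < c.

Definition sqdist (th : 'cV[R]_p * 'M[R]_p) i : R :=
  qform (invmx th.2) (colv (x i) - th.1).

Definition likelihood th : R := \prod_(i in D) density g th (x i).

Let pR_gt0 : 0 < p%:R :> R. Proof. by rewrite ltr0n. Qed.
Let gamma_gt0 : 0 < gamma.
Proof. by apply: lt_trans gamma_gt; rewrite divr_gt0. Qed.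

Let card_gtM : p%:R * gamma < #|D|%:R * (gamma - p%:R / 2).
Proof. by move: card_gt; rewrite ltr_pdivrMr// subr_gt0. Qed.

Let p_lt_card : (p < #|D|)%N.
Proof. by rewrite -(ltr_nat R); move: card_gtM gamma_gt pR_gt0; nra. Qed.

Lemma sqdist_ge0 th i : posdefmx th.2 -> 0 <= sqdist th i.
Proof. by move=> pd; exact/qform_ge0/invmx_posdef. Qed.

(** Squaring removes the square root of the determinant, so that the estimates involve its integer
    powers only. *)
Lemma likelihood_sqr th : posdefmx th.2 ->
  likelihood th ^+ 2 * \det th.2 ^+ #|D| = (\prod_(i in D) g (sqdist th i)) ^+ 2.
Proof.
move=> pd; have d0 := posdef_det_gt0 p_gt0 pd.
rewrite /likelihood /density big_split/= prodr_const exprMn.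
rewrite -exprM mulnC exprM exprVn sqr_sqrtr ?ltW// mulrAC -exprMn.
by rewrite mulVf ?gt_eqF// expr1n mul1r.
Qed.

Let g_dist_bounds th i : posdefmx th.2 -> 0 <= g (sqdist th i) <= g 0.
Proof. by move=> pd; rewrite g_ge0 ?g_noninc ?sqdist_ge0. Qed.

(** Common to the three bounds below: on [c <= likelihood th], an estimate of the product of the
    values of [g] is weighed against the determinant. *)
Let sqr_le_likelihood th B : posdefmx th.2 -> c <= likelihood th ->
  \prod_(i in D) g (sqdist th i) <= B ->
  c ^+ 2 * \det th.2 ^+ #|D| <= B ^+ 2.
Proof.
move=> pd cl pB; have d0 := posdef_det_gt0 p_gt0 pd.
have P0 : 0 <= \prod_(i in D) g (sqdist th i).
  by apply: prodr_ge0 => i _; case/andP: (g_dist_bounds i pd).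
apply: (@le_trans _ _ (likelihood th ^+ 2 * \det th.2 ^+ #|D|)).
  by rewrite ler_wpM2r ?exprn_ge0 ?(ltW d0)// lerXn2r// nnegrE ltW// (lt_le_trans c_gt0).
by rewrite likelihood_sqr// lerXn2r// nnegrE// (le_trans P0).
Qed.

Lemma likelihood_scatter_lower : exists2 a, 0 < a &
  forall th, posdefmx th.2 -> c <= likelihood th ->
  forall (v : 'cV_p) i, a * v i 0 ^+ 2 <= qform th.2 v.
Proof.
have [C C0 gC] := tail_decay_bound g_ge0 g_noninc gamma_gt0 g_tail.
have [d d0 gap] := general_position_gap gpD.
pose q := (#|D| - p)%N.
pose E := C / (d ^+ 2) `^ gamma.
have E0 : 0 < E by rewrite divr_gt0 ?powR_gt0 ?exprn_gt0.
pose K := (g 0 ^+ p * E ^+ q) ^+ 2 + 1.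
have K0 : 0 < K by rewrite ltr_wpDl// sqr_ge0.
(* Twice the exponent of [l] in the likelihood estimate, because of the squaring; [card_gt] says
   that it is positive. *)
pose e := gamma * (2 * q)%:R - (p * #|D|)%:R.
have e0 : 0 < e.
  rewrite /e !natrM /q natrB ?(ltnW p_lt_card)//.
  by move: card_gtM; lra.
exists ((c ^+ 2 / K) `^ e^-1); first by rewrite powR_gt0// divr_gt0// exprn_gt0.
move=> th pd cl v i.
have [u [k [l [l0 uk ul lS]]]] := posdef_min_qform p_gt0 pd.
apply: le_trans (lS v i); rewrite ler_wpM2r ?sqr_ge0//.
pose T := g (d ^+ 2 / l).
have dl0 : 0 <= d ^+ 2 / l by rewrite divr_ge0 ?sqr_ge0 ?ltW.
have TE : T <= E * l `^ gamma.
  rewrite /E mulrAC ler_pdivlMr ?powR_gt0 ?exprn_gt0//.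
  have -> : d ^+ 2 = d ^+ 2 / l * l by rewrite divfK// gt_eqF.
  rewrite powRM ?(ltW l0)// mulrA (mulrC T) ler_wpM2r ?powR_ge0//.
  exact: gC.
have prodT : \prod_(i in D) g (sqdist th i) <= g 0 ^+ p * T ^+ q.
  (* The hyperplane through the center [th.1] with normal [u] has at most [p] points in its slab of
     half-width [d]; each other point has squared distance at least [d ^+ 2 / l]. *)
  pose mu := (u^T *m th.1) 0 0.
  apply: (@prod_le_two_bounds _ D [set i in D | `|linform u (x i) - mu| < d]).
  - by apply/fintype.subsetP => j; rewrite inE => /andP[].
  - by rewrite (ltnW p_lt_card) andbT; exact: gap uk.
  - by rewrite g_ge0 ?g_noninc.
  - by move=> j _; exact: g_dist_bounds.
  move=> j; rewrite !inE => /andP[+ jD]; rewrite jD/= -leNgt => dj.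
  apply: g_noninc => //; rewrite ler_pdivrMr// mulrC -ul.
  apply: le_trans (mahalanobis_ge pd _ _).
  have -> : (u^T *m (colv (x j) - th.1)) 0 0 = linform u (x j) - mu.
    by rewrite mulmxBr mxE [X in _ + X]mxE.
  by rewrite -(real_normK (num_real (_ - _))) lerXn2r// nnegrE ltW.
have := sqr_le_likelihood pd cl prodT => h.
have detl : l ^+ p <= \det th.2. exact: det_ge_exp (proj1 pd) l0 lS.
have : c ^+ 2 * l ^+ (p * #|D|) <= K * l `^ (gamma * (2 * q)%:R).
  apply: (@le_trans _ _ (c ^+ 2 * \det th.2 ^+ #|D|)).
    rewrite ler_wpM2l ?sqr_ge0// exprM lerXn2r// nnegrE ?exprn_ge0 ?ltW//.
    exact: posdef_det_gt0.
  apply: (le_trans h).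
  apply: (@le_trans _ _ ((g 0 ^+ p * (E * l `^ gamma) ^+ q) ^+ 2)).
    have T0 : 0 <= T by rewrite g_ge0.
    have E1 : 0 <= E * l `^ gamma by rewrite mulr_ge0 ?powR_ge0 ?ltW.
    have G0 : 0 <= g 0 by rewrite g_ge0.
    by apply: lerXn2r; rewrite ?nnegrE ?mulr_ge0 ?exprn_ge0// ler_wpM2l ?exprn_ge0// lerXn2r.
  have -> : (g 0 ^+ p * (E * l `^ gamma) ^+ q) ^+ 2 =
      (g 0 ^+ p * E ^+ q) ^+ 2 * l `^ (gamma * (2 * q)%:R).
    by rewrite powRrM powR_mulrn ?powR_ge0// [(2 * q)%N]mulnC exprM !exprMn; ring.
  by rewrite ler_wpM2r ?powR_ge0// lerDl.
have -> : l `^ (gamma * (2 * q)%:R) = l `^ e * l ^+ (p * #|D|).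
  rewrite -powR_mulrn ?(ltW l0)// -powRD ?subrK//.
  by rewrite (gt_eqF l0) implybT.
rewrite mulrA ler_pM2r ?exprn_gt0// => cK.
have : c ^+ 2 / K <= l `^ e by rewrite ler_pdivrMr// mulrC.
have c2 : 0 <= c ^+ 2 / K by rewrite divr_ge0 ?sqr_ge0 ?ltW.
have ei0 : 0 <= e^-1 by rewrite invr_ge0 ltW.
move=> /(ge0_ler_powR ei0); rewrite !nnegrE powR_ge0 => /(_ c2 isT) /le_trans; apply.
by rewrite -powRrM mulfV ?gt_eqF// powRr1// ltW.
Qed.

Lemma likelihood_scatter_upper a : 0 < a -> exists b, forall th, posdefmx th.2 ->
  c <= likelihood th ->
  (forall (v : 'cV_p) i, a * v i 0 ^+ 2 <= qform th.2 v) ->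
  forall i, th.2 i i <= b.
Proof.
(* [B] bounds the determinant in both cases: either it is at most 1, or it is at most its own power
   [#|D|], which the likelihood controls. *)
move=> a0; pose B := 1 + (g 0 ^+ #|D|) ^+ 2 / c ^+ 2.
exists (B / a ^+ p.-1) => th pd cl la i; have d0 := posdef_det_gt0 p_gt0 pd.
rewrite ler_pdivlMr ?exprn_gt0// mulrC.
apply: le_trans (det_ge_qform_min i (proj1 pd) a0 la) _.
have B1 : 1 <= B by rewrite lerDl divr_ge0 ?sqr_ge0.
have [d1|d1] := leP (\det th.2) 1; first exact: le_trans B1.
have : \prod_(i in D) g (sqdist th i) <= g 0 ^+ #|D|.
  by rewrite -prodr_const; apply: ler_prod => j _; exact: g_dist_bounds.
move=> /(sqr_le_likelihood pd cl); rewrite mulrC -ler_pdivlMr ?exprn_gt0// => h.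
apply: (@le_trans _ _ (\det th.2 ^+ #|D|)).
  by rewrite ler_eXnr ?(leq_trans _ p_lt_card)// ltW.
by apply: (le_trans h); rewrite lerDr.
Qed.

(** A single observation suffices. The other values of [g] are at most [g 0] and the determinant is
    at least [a ^+ p], so [g] at its distance is bounded below; the tail then bounds this distance,
    and the diagonal bound [b] turns it into a coordinatewise one. *)
Lemma likelihood_location_bound a b : 0 < a -> exists M, forall th, posdefmx th.2 ->
  c <= likelihood th ->
  (forall (v : 'cV_p) i, a * v i 0 ^+ 2 <= qform th.2 v) ->
  (forall i, th.2 i i <= b) ->
  forall i, `|th.1 i 0| <= M.
Proof.
move=> a0.
have [C C0 gC] := tail_decay_bound g_ge0 g_noninc gamma_gt0 g_tail.
have [i0 i0D] : exists i, i \in D.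
  by apply/card_gt0P; exact: leq_ltn_trans p_lt_card.
pose Q := (g 0 ^+ #|D|.-1) ^+ 2 * (a ^+ p) ^- #|D| + 1.
have Q0 : 0 < Q by rewrite ltr_wpDl// mulr_ge0 ?sqr_ge0 ?invr_ge0 ?exprn_ge0 ?ltW.
pose g1 := Num.sqrt (c ^+ 2 / Q).
have g10 : 0 < g1 by rewrite sqrtr_gt0 divr_gt0 ?exprn_gt0.
pose rho := (C / g1) `^ gamma^-1.
exists (\sum_j `|tnth (x i0) j| + (1 + b * rho)) => th pd cl la lb j.
have r0 := sqdist_ge0 i0 pd.
have gr : g1 <= g (sqdist th i0).
  rewrite -(ger0_norm (g_ge0 r0)) -sqrtr_sqr ler_wsqrtr// ler_pdivrMr//.
  have : \prod_(i in D) g (sqdist th i) <= g (sqdist th i0) * g 0 ^+ #|D|.-1.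
    rewrite (bigD1 i0)//= ler_wpM2l ?g_ge0//.
    have -> : #|D|.-1 = #|[pred i in D | i != i0]|.
      by rewrite (cardD1 i0) i0D/=; apply: eq_card => i; rewrite !inE andbC.
    by rewrite -prodr_const; apply: ler_prod => i _; exact: g_dist_bounds.
  move=> /(sqr_le_likelihood pd cl) h.
  have detm : (a ^+ p) ^+ #|D| <= \det th.2 ^+ #|D|.
    have detp := det_ge_exp (proj1 pd) a0 la.
    have ap0 : 0 <= a ^+ p by rewrite exprn_ge0// ltW.
    by apply: lerXn2r; rewrite ?nnegrE// (le_trans ap0).
  have am0 : 0 < (a ^+ p) ^+ #|D| by rewrite !exprn_gt0.
  have : c ^+ 2 * (a ^+ p) ^+ #|D| <= (g (sqdist th i0) * g 0 ^+ #|D|.-1) ^+ 2.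
    by apply: le_trans h; rewrite ler_wpM2l ?sqr_ge0.
  rewrite -ler_pdivlMr// => /le_trans; apply.
  by rewrite exprMn -mulrA ler_wpM2l ?sqr_ge0// lerDl.
have rrho : sqdist th i0 <= rho.
  have ei0 : 0 <= gamma^-1 by rewrite invr_ge0 ltW.
  have : sqdist th i0 `^ gamma <= C / g1.
    rewrite ler_pdivlMr//; apply: le_trans (gC _ r0).
    by rewrite ler_wpM2l ?powR_ge0.
  move=> /(ge0_ler_powR ei0); rewrite !nnegrE powR_ge0 divr_ge0 ?(ltW C0) ?(ltW g10)//.
  by rewrite -powRrM mulfV ?gt_eqF// powRr1//; exact.
have := mahalanobis_ge pd (delta_mx j 0) (colv (x i0) - th.1).
rewrite -/(sqdist th i0) qform_delta trmx_delta -rowE !mxE => h.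
have h2 : (tnth (x i0) j - th.1 j 0) ^+ 2 <= b * rho.
  apply: (le_trans h); apply: ler_pM => //.
  exact/ltW/posdef_diag_gt0.
have : `|tnth (x i0) j| <= \sum_j `|tnth (x i0) j|.
  by rewrite (bigD1 j)//= lerDl; exact: sumr_ge0.
have : `|th.1 j 0| <= `|tnth (x i0) j| + `|tnth (x i0) j - th.1 j 0|.
  by rewrite -{1}(subKr (tnth (x i0) j) (th.1 j 0)); exact: ler_normB.
(* This uses [t <= 1 + t ^+ 2], which avoids a square root. *)
have : `|tnth (x i0) j - th.1 j 0| <= 1 + b * rho.
  by move: h2; rewrite -real_normK ?num_real// => h2; nra.
lra.
Qed.

End coercivity.

End likelihood.

(** * Continuity of the truncated likelihood *)

Section truncated_likelihood.
Context {R : realType}.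

(** [g] is controlled on the half-line only; it is replaced by [g (Num.max r 0)], which is
    continuous on all of [R] and agrees with [g] on the range of [f]. *)
Lemma measurable_within_continuous (g : R -> R) d (T : measurableType d) (f : T -> R) :
  {within [set r | 0 <= r], continuous g} -> (forall t, 0 <= f t) ->
  measurable_fun setT f -> measurable_fun setT (g \o f).
Proof.
move=> /subspace_continuousP cg f0 mf.
have -> : g \o f = (fun r => g (Num.max r 0)) \o f.
  by apply/funext => t /=; rewrite max_l.
apply: (@measurableT_comp _ _ _ _ _ _ (fun r : R => g (Num.max r 0))) => //.
apply: continuous_measurable_fun => r.
have /cg : [set r | 0 <= r] (Num.max r 0) by rewrite /= le_max lexx orbT.
apply: (@cvg_comp _ _ _ (fun y => Num.max y 0) g _
  (within [set r | 0 <= r] (nbhs (Num.max r 0)))) => B /= gB.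
have : Num.max y 0 @[y --> r] --> Num.max r 0.
  rewrite maxr_absE; under eq_cvg do rewrite maxr_absE.
  apply: cvgM; last exact: cvg_cst.
  apply: cvgD; first by apply: cvgD; [exact: cvg_id|exact: cvg_cst].
  by apply: cvg_norm; apply: cvgB; [exact: cvg_id|exact: cvg_cst].
move=> /(_ _ gB) h; change (nbhs r [set y | B (Num.max y 0)]).
have : nbhs r [set y | 0 <= Num.max y 0 -> B (Num.max y 0)] by exact: h.
by apply: filterS => y; apply; rewrite le_max lexx orbT.
Qed.

Lemma measurable_qform p (S : 'M[R]_p) (mu : 'cV[R]_p) :
  measurable_fun setT (fun x : p.-tuple R => qform S (colv x - mu)).
Proof.
have mc i : measurable_fun setT (fun x : p.-tuple R => (colv x - mu) i 0).
  under eq_fun do rewrite !mxE.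
  by apply: measurable_funB; [exact: measurable_tnth|exact: measurable_cst].
rewrite (_ : (fun x => _) = fun x : p.-tuple R =>
  \sum_j (\sum_i (colv x - mu) i 0 * S i j) * (colv x - mu) j 0); last first.
  apply/funext => x; rewrite /qform mxE; apply: eq_bigr => j _.
  by rewrite mxE; congr (_ * _); apply: eq_bigr => i _; rewrite mxE.
apply: measurable_sum => j; apply: measurable_funM => //.
by apply: measurable_sum => i; apply: measurable_funM.
Qed.

Section family.
Variables (p : nat) (g : R -> R).
Hypothesis g_ell : elliptical_family p g.
Hypothesis g_cont : G2 g.
Hypothesis p_gt0 : (0 < p)%N.

Lemma density_ge0 (th : 'cV[R]_p * 'M[R]_p) x : Theta th -> 0 <= density g th x.
Proof.
have [g0 _ _] := g_ell => pd.
rewrite /density mulr_ge0 ?invr_ge0 ?sqrtr_ge0// g0//.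
exact/qform_ge0/invmx_posdef.
Qed.

Lemma measurable_density (th : 'cV[R]_p * 'M[R]_p) :
  Theta th -> measurable_fun setT (density g th).
Proof.
move=> pd; apply: measurable_funM; first exact: measurable_cst.
apply: (@measurable_within_continuous g _ _
  (fun x => qform (invmx th.2) (colv x - th.1))) => //.
  by move=> x; exact/qform_ge0/invmx_posdef.
exact: measurable_qform.
Qed.

Lemma Pth_bounds (th : 'cV[R]_p * 'M[R]_p) A : measurable A -> Theta th ->
  (0 <= Pth g th A <= 1)%E.
Proof.
move=> mA pd; have [_ _ P1] := g_ell.
rewrite integral_ge0 ?andTb => [|x _]; last by rewrite lee_fin density_ge0.
rewrite -(P1 th pd); apply: ge0_subset_integral => //.
- apply/measurable_EFinP; exact: measurable_density.
- by move=> x _; rewrite lee_fin density_ge0.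
Qed.

Variables (th_ : nat -> 'cV[R]_p * 'M[R]_p) (th : 'cV[R]_p * 'M[R]_p).
Hypothesis th_Theta : forall k, Theta (th_ k).
Hypothesis thTheta : Theta th.
Hypothesis th_cvg1 : cvg_entries (fun k => (th_ k).1) th.1.
Hypothesis th_cvg2 : cvg_entries (fun k => (th_ k).2) th.2.

Lemma density_cvg x : density g (th_ k) x @[k --> \oo] --> density g th x.
Proof.
have dpos (t : 'cV[R]_p * 'M[R]_p) : Theta t -> 0 < \det t.2.
  exact: posdef_det_gt0.
apply: cvgM.
  apply: cvgV; first by rewrite gt_eqF// sqrtr_gt0 dpos.
  apply: continuous_cvg; first exact: sqrt_continuous.
  exact: cvg_entries_det.
apply: (cvg_within_seq g_cont) => [k|/=|].
- exact/qform_ge0/invmx_posdef/th_Theta.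
- exact/qform_ge0/invmx_posdef.
have cx : cvg_entries (fun k => colv x - (th_ k).1) (colv x - th.1).
  by apply: cvg_entriesB => //; exact: cvg_entries_cst.
have ci : cvg_entries (fun k => invmx (th_ k).2) (invmx th.2).
  apply: cvg_entries_inv => [k||//]; last exact: posdef_unitmx.
  exact/posdef_unitmx/th_Theta.
exact: (cvg_entriesM (cvg_entriesM (cvg_entries_tr cx) ci) cx).
Qed.

Lemma Pth_cvg A : measurable A -> Pth g (th_ k) A @[k --> \oo] --> Pth g th A.
Proof.
move=> mA; have [_ _ P1] := g_ell.
apply: scheffe_cvg => //.
- by move=> k; exact: measurable_density.
- exact: measurable_density.
- by move=> k x; exact: density_ge0.
- by move=> x; exact: density_ge0.
- exact: density_cvg.
- by move=> k; exact: P1.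
- exact: P1.
Qed.

End family.

Lemma sum_lne_gt0 (I : finType) (D : {pred I}) (f : I -> R) :
  (forall i, i \in D -> 0 < f i) ->
  (\sum_(i in D) lne (f i)%:E = (ln (\prod_(i in D) f i))%:E)%E.
Proof.
move=> f0; have [] // : (0 < \prod_(i in D) f i) /\
  (\sum_(i in D) lne (f i)%:E = (ln (\prod_(i in D) f i))%:E)%E.
elim/big_ind2 : _ => // [|x u y v [u0 ->] [v0 ->]|i iD].
- by rewrite ln1.
- by rewrite mulr_gt0// lnM ?posrE.
- by rewrite f0// lne_EFin// f0.
Qed.

Lemma le_sum_lne (I : finType) (D : {pred I}) (f h : I -> R) :
  (forall i, i \in D -> 0 <= f i) -> (forall i, i \in D -> 0 <= h i) ->
  \prod_(i in D) f i <= \prod_(i in D) h i ->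
  (\sum_(i in D) lne (f i)%:E <= \sum_(i in D) lne (h i)%:E)%E.
Proof.
move=> f0 h0 fh.
(* A zero factor makes the left sum [-oo]. Otherwise the product of the [f i] is positive, hence so
   is every [h i], and real logarithms apply. *)
have [[i iD fi]|nf] := pselect (exists2 i, i \in D & f i = 0).
  by rewrite (bigD1 i)//= fi lexx addNye leNye.
have fp i : i \in D -> 0 < f i.
  by move=> iD; rewrite lt_def f0// andbT; apply/eqP => fi; apply: nf; exists i.
have pf : 0 < \prod_(i in D) f i by exact: prodr_gt0.
have hp i : i \in D -> 0 < h i.
  move=> iD; rewrite lt_def h0// andbT; apply/eqP => hi.
  by move: (lt_le_trans pf fh); rewrite (bigD1 i)//= hi mul0r ltxx.
by rewrite !sum_lne_gt0// lee_fin ler_ln// posrE// (lt_le_trans pf).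
Qed.

End truncated_likelihood.

(** * Existence of a maximizer *)

Section maximizer.
Context {R : realType}.
Variables (p n : nat) (g : R -> R) (gamma : R) (x : 'I_n -> p.-tuple R).
Variables (D : {set 'I_n}) (A : set (p.-tuple R)) (alpha : R).
Hypothesis p_gt0 : (0 < p)%N.
Hypothesis g_ell : elliptical_family p g.
Hypothesis g_cont : G2 g.
Hypothesis gamma_gt : p%:R / 2 < gamma.
Hypothesis g_tail : tail_decay g gamma.
Hypothesis card_gt : p%:R * gamma / (gamma - p%:R / 2) < #|D|%:R.
Hypothesis gpD : general_position x D.
Hypothesis mA : measurable A.
Hypothesis alpha_gt0 : 0 < alpha.

(** On [Theta_ge], when [D] indexes the points in [A], this is the exponential of [n] times the
    empirical truncated log-likelihood. It stays real when a density vanishes at a data point. *)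
Definition trunc_likelihood (th : 'cV[R]_p * 'M[R]_p) : R :=
  likelihood g x D th / fine (Pth g th A) ^+ #|D|.

Lemma likelihood_ge0 th : Theta th -> 0 <= likelihood g x D th.
Proof. by move=> pd; apply: prodr_ge0 => i _; exact: density_ge0. Qed.

Lemma Theta_geE th : Theta_ge g A alpha th <->
  [/\ Theta th, Pth g th A = (fine (Pth g th A))%:E & alpha <= fine (Pth g th A)].
Proof.
split=> [[pd aP]|[pd PE aP]]; last by split => //; rewrite PE lee_fin.
have /andP[P0 P1] := Pth_bounds g_ell g_cont mA pd.
have Pfin : Pth g th A \is a fin_num by rewrite ge0_fin_numE// (le_lt_trans P1) ?ltry.
by rewrite fineK//; split => //; rewrite -lee_fin fineK.
Qed.

(** Sequential compactness of the level set together with continuity of the objective, in the form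
    required by [max_attained_seq]. *)
Lemma Theta_ge_subsequence c (th_ : nat -> 'cV[R]_p * 'M[R]_p) : 0 < c ->
  (forall k, Theta_ge g A alpha (th_ k) /\ c <= likelihood g x D (th_ k)) ->
  exists (h : nat -> nat) th, [/\ h @ \oo --> \oo,
    Theta_ge g A alpha th /\ c <= likelihood g x D th &
    trunc_likelihood (th_ (h k)) @[k --> \oo] --> trunc_likelihood th].
Proof.
move=> c0 th_P; have [g0 gn _] := g_ell.
have th_T k : Theta (th_ k) by case: (th_P k) => -[].
have cl k : c <= likelihood g x D (th_ k) by case: (th_P k).
have [a a0 la] := likelihood_scatter_lower p_gt0 g0 gn gamma_gt g_tail card_gt gpD c0.
have [b lb] := likelihood_scatter_upper x p_gt0 g0 gn gamma_gt card_gt c0 a0.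
have [M lM] := likelihood_location_bound x p_gt0 g0 gn gamma_gt g_tail card_gt c0 b a0.
have aS k := la _ (th_T k) (cl k).
have Sb k := lb _ (th_T k) (cl k) (aS k).
(* The entries of location and scatter form one finite family, so that a single extraction serves
   them all. *)
pose u (i : 'I_p + 'I_p * 'I_p) k : R :=
  match i with inl j => (th_ k).1 j 0 | inr j => (th_ k).2 j.1 j.2 end.
have uM i k : `|u i k| <= Num.max M b.
  case: i => [i|[i j]] /=; rewrite le_max.
    by rewrite (lM _ (th_T k) (cl k) (aS k) (Sb k)).
  by rewrite (posdef_entry_le i j (th_T k) (Sb k)) orbT.
have [h hoo uh] := common_cvg_subsequence uM.
pose th : 'cV[R]_p * 'M[R]_p := (\col_i lim (u (inl i) \o h @ \oo),
  \matrix_(i, j) lim (u (inr (i, j)) \o h @ \oo)).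
have th1 : cvg_entries (fun k => (th_ (h k)).1) th.1.
  by move=> i j; rewrite ord1 mxE; exact: (uh (inl i)).
have th2 : cvg_entries (fun k => (th_ (h k)).2) th.2.
  by move=> i j; rewrite mxE; exact: (uh (inr (i, j))).
have thT : Theta th.
  split.
    apply/matrixP => i j; rewrite !mxE.
    suff -> : u (inr (j, i)) = u (inr (i, j)) by [].
    by apply/funext => k /=; rewrite -[in LHS](proj1 (th_T k)) mxE.
  move=> v v0; have [i vi] : exists i, v i 0 != 0.
    by apply: contrapT => /forallNP vN; move/eqP: v0; apply;
       apply/matrixP => i j; rewrite ord1 mxE; exact/eqP/negPn/negP/vN.
  (* The lower bound [a] is uniform in [k] and survives the limit, which keeps the limit matrix
     positive definite. *)
  apply: (@lt_le_trans _ _ (a * v i 0 ^+ 2)).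
    by rewrite mulr_gt0// exprn_even_gt0.
  have vSv := cvg_entriesM (cvg_entriesM (@cvg_entries_cst _ _ _ v^T) th2)
    (@cvg_entries_cst _ _ _ v).
  apply: (ler_cvg_to (cvg_cst _) (vSv 0 0)).
  by apply: nearW => k; exact: aS.
have likh : likelihood g x D (th_ (h k)) @[k --> \oo] --> likelihood g x D th.
  by apply: cvg_prod_seq => i _; exact: (density_cvg g_cont p_gt0 (fun k => th_T (h k))).
have Ph := Pth_cvg g_ell g_cont p_gt0 (fun k => th_T (h k)) thT th1 th2 mA.
have aP : (alpha%:E <= Pth g th A)%E.
  by apply: (lee_cvg_to (cvg_cst _) Ph); apply: nearW => k; case: (th_P (h k)) => -[].
have /Theta_geE[_ PE aPf] : Theta_ge g A alpha th by [].
exists h, th; split => //.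
  split => //; apply: (ler_cvg_to (cvg_cst _) likh); exact: nearW.
apply: cvgM => //; apply: cvgV.
  by rewrite expf_neq0// gt_eqF// (lt_le_trans alpha_gt0).
have Pf : fine (Pth g (th_ (h k)) A) @[k --> \oo] --> fine (Pth g th A).
  by apply: fine_cvg; rewrite -PE.
exact: (@continuous_cvg _ _ _ _ _ _ _ _ (@exprn_continuous R #|D| _) Pf).
Qed.

Lemma trunc_likelihood_max : Theta_ge g A alpha !=set0 ->
  exists2 th, Theta_ge g A alpha th &
  forall t, Theta_ge g A alpha t -> trunc_likelihood t <= trunc_likelihood th.
Proof.
move=> [t0 t0P].
have [[t1 t1P H1]|H0] := pselect
  (exists2 t, Theta_ge g A alpha t & 0 < trunc_likelihood t);
  last first.
  (* If the objective vanishes throughout the constraint set, any of its elements is a maximizer. *)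
  exists t0 => // t tP; apply: (@le_trans _ _ 0).
    by rewrite leNgt; apply/negP => Ht; apply: H0; exists t.
  have /Theta_geE[pd _ aP] := t0P.
  by rewrite divr_ge0 ?likelihood_ge0// exprn_ge0// (le_trans (ltW alpha_gt0)).
(* With this level, a parameter with likelihood below [c] has truncated likelihood at most that of
   [t1], as its probability of [A] is at least [alpha]; [t1] itself lies in the level set. *)
pose c := trunc_likelihood t1 * alpha ^+ #|D|.
have c0 : 0 < c by rewrite mulr_gt0// exprn_gt0.
have am0 : 0 < alpha ^+ #|D| by rewrite exprn_gt0.
have aPm t : Theta_ge g A alpha t -> alpha ^+ #|D| <= fine (Pth g t A) ^+ #|D|.
  move=> /Theta_geE[_ _ aP].
  by apply: lerXn2r; rewrite ?nnegrE ?(ltW alpha_gt0) ?(le_trans (ltW alpha_gt0) aP).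
have t1c : c <= likelihood g x D t1.
  rewrite /c /trunc_likelihood mulrAC ler_pdivrMr;
    last exact: lt_le_trans (aPm _ t1P).
  by rewrite ler_wpM2l ?aPm// likelihood_ge0//; case: t1P.
have [||th [thP cth] thmax] := @max_attained_seq _ _
  [set t | Theta_ge g A alpha t /\ c <= likelihood g x D t] trunc_likelihood.
- by exists t1.
- by move=> t tP; exact: Theta_ge_subsequence.
exists th => // t tP; have [ct|tc] := leP c (likelihood g x D t); first exact: thmax.
apply: le_trans (thmax t1 (conj t1P t1c)).
have Pm0 : 0 < fine (Pth g t A) ^+ #|D| by exact: lt_le_trans (aPm _ tP).
rewrite ler_pdivrMr//; apply: (le_trans (ltW tc)).
by rewrite /c ler_wpM2l ?aPm// ltW.
Qed.

Lemma empirical_trunc_loglik th : D = [set i | x i \in A]%SET ->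
  Theta_ge g A alpha th ->
  empirical x (trunc_loglik g th A) = ((n%:R^-1)%:E *
    \sum_(i in D) lne (density g th (x i) / fine (Pth g th A))%:E)%E.
Proof.
move=> DA /Theta_geE[pd PE aP].
have P0 : fine (Pth g th A) != 0 by rewrite gt_eqF// (lt_le_trans alpha_gt0).
rewrite /empirical; congr (_ * _)%E; rewrite [RHS]big_mkcond/=; apply: eq_bigr => i _.
rewrite /trunc_loglik PE eqe (negbTE P0) inver (negbTE P0) -EFinM DA inE indicE.
by case: (x i \in A); rewrite ?mul1e ?mul0e.
Qed.

Lemma le_empirical_trunc_loglik t th : D = [set i | x i \in A]%SET ->
  Theta_ge g A alpha t -> Theta_ge g A alpha th ->
  trunc_likelihood t <= trunc_likelihood th ->
  (empirical x (trunc_loglik g t A) <= empirical x (trunc_loglik g th A))%E.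
Proof.
move=> DA tP thP le_tth; rewrite !empirical_trunc_loglik//.
have HE s : \prod_(i in D) (density g s (x i) / fine (Pth g s A)) = trunc_likelihood s.
  by rewrite big_split/= prodr_const exprVn.
have f0 s i : Theta_ge g A alpha s -> 0 <= density g s (x i) / fine (Pth g s A).
  move=> /Theta_geE[pd _ aP].
  by rewrite divr_ge0 ?density_ge0// (le_trans (ltW alpha_gt0)).
apply: lee_wpmul2l; first by rewrite lee_fin invr_ge0.
by apply: le_sum_lne => [i _|i _|]; rewrite ?f0// !HE.
Qed.

End maximizer.

Theorem proposition2p6 (R : realType) (p n : nat) (g : R -> R) (gamma : R)
    (x : 'I_n -> p.-tuple R) (A : set (p.-tuple R)) (m : nat) (alpha : R)
    (hp : (0 < p)%N)
    (hg : elliptical_family p g) (hG1 : G1 g) (hG2 : G2 g)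
    (hGp : Gp p g gamma)
    (mA : measurable A)
    (hm : m = #|[pred i | x i \in A]|)
    (hm1 : p = 1%N -> (2 < m)%N)
    (hmp : (1 < p)%N -> p%:R * gamma / (gamma - p%:R / 2) < m%:R)
    (htail1 : p = 1%N -> univariate_tail g m)
    (halpha : 0 < alpha)
    (hne : Theta_ge g A alpha !=set0)
    (hgp : general_position x [pred i | x i \in A]) :
  exists2 th_hat, Theta_ge g A alpha th_hat &
    empirical x (trunc_loglik g th_hat A) =
    ereal_sup [set empirical x (trunc_loglik g th A)
              | th in Theta_ge g A alpha].
Proof.
(* The exponent comes from [Gp] when [p > 1] and from [univariate_tail] when [p = 1]; the rest of
   the argument is common to both cases. *)
have [gam [gam1 gam2 gam3]] : exists gam : R, [/\ p%:R / 2 < gam, tail_decay g gam &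
    p%:R * gam / (gam - p%:R / 2) < m%:R].
  have [p1|p1] := leqP p 1; last first.
    by have [? ?] := hGp p1; exists gamma; split => //; exact: hmp.
  have pE : p = 1%N by apply/eqP; rewrite eqn_leq p1 hp.
  have [gam] := htail1 pE; rewrite !mul1r => hgam.
  by exists gam; rewrite pE !mul1r.
pose D : {set 'I_n} := [set i | x i \in A]%SET.
have mD : m = #|D| by rewrite hm cardsE.
have gpD : general_position x D.
  move=> I ID; apply: hgp; apply: fintype.subset_trans ID _.
  by apply/fintype.subsetP => i; rewrite inE.
rewrite mD in gam3.
have [th thP thmax] := trunc_likelihood_max hp hg hG2 gam1 gam2 gam3 gpD mA halpha hne.
exists th => //; apply/eqP; rewrite eq_le; apply/andP; split.
  by apply: ereal_sup_ubound; exists th.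
apply: ge_ereal_sup => _ [t tP <-].
by apply: (@le_empirical_trunc_loglik _ _ _ _ _ D A alpha) => //; exact: thmax.
Qed.
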